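(* The spanning tree enumerator $$ f_{n_1,\ldots,n_r}(q,x):=\sum_{T \in \mathrm{Tree}(K_{n_1} \times \cdots \times K_{n_r})} q^{\mathrm{dir}(T)}\, x^{\mathrm{dd}(T)} $$ is divisible by $$q_i^{n_i-1},$$ by $$\left( x^{(i)}_j \right)^{n_1 \cdots n_{i-1} n_{i+1} \cdots n_r}$$ and by $$\left( x^{(i)}_1 + \cdots + x^{(i)}_{n_i} \right)^{n_i-2}$$ for each $i \in [r]$ and $j \in [n_i]$.
   Context: Notation: $[m]=\{1,2,\ldots,m\}$. $K_m$ is the complete graph on vertex set $[m]$. The Cartesian product $K_{n_1}\times\cdots\times K_{n_r}$ is the graph whose vertices are the $r$-tuples $(j_1,\ldots,j_r)\in[n_1]\times\cdots\times[n_r]$, with an edge joining two $r$-tuples exactly when they differ in exactly one coordinate. An edge lies in direction $i$ if its two endpoints differ in their $i$-th coordinate. $\mathrm{Tree}(G)$ denotes the set of all spanning trees of a graph $G$. There are independent variables $q_1,\ldots,q_r$ and, for each $i\in[r]$ and $j\in[n_i]$, a variable $x^{(i)}_j$ (here $(i)$ is an upper index, not an exponent); the enumerator is a polynomial in $\mathbb{Z}[q_i, x^{(i)}_j]$. For a spanning tree $T$ of $K_{n_1}\times\cdots\times K_{n_r}$, the direction monomial is $$q^{\mathrm{dir}(T)}:=\prod_{i=1}^r q_i^{|\{\text{edges in } T \text{ in direction } i\}|},$$ and the decoupled degree monomial is $$x^{\mathrm{dd}(T)} := \prod_{v=(j_1,\ldots,j_r)\in [n_1]\times\cdots\times[n_r]}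 \left( x^{(1)}_{j_1} x^{(2)}_{j_2}\cdots x^{(r)}_{j_r}\right)^{\deg_T(v)},$$ where $\deg_T(v)$ is the degree of the vertex $v$ in $T$.
   Formalization: Divisibility by the power of x^(i)_j is stated only when n_1⋯n_r > 1: if all n_i = 1 the graph is a single vertex, the enumerator is 1, and x^(i)_1 does not divide it. *)

(* Defs.v *)
From HB Require Import structures.
From mathcomp Require Import all_boot all_order all_algebra.
From mathcomp Require Import mpoly.

Set Implicit Arguments.
Unset Strict Implicit.
Unset Printing Implicit Defensive.

Import GRing.Theory.
Local Open Scope ring_scope.

Section SpanningTrees.

Variables (V : finType) (e : rel V).

(* Meant for symmetric irreflexive e; an edge is its two-element set of
   endpoints. *)
Definition edges : {set {set V}} :=
  [set [set p.1; p.2] | p : V * V & e p.1 p.2].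

Definition edge_rel (T : {set {set V}}) : rel V :=
  fun u v => (u != v) && ([set u; v] \in T).

Definition connected_edges (T : {set {set V}}) : bool :=
  [forall u, forall v, connect (edge_rel T) u v].

(* A cycle is a sequence of at least 3 distinct vertices, cyclically adjacent;
   its length is at most #|V|, hence the bounded quantifier. *)
Definition acyclic_edges (T : {set {set V}}) : bool :=
  [forall k : 'I_#|V|.+1, forall c : k.-tuple V,
     (2 < k)%N ==> ~~ ucycleb (edge_rel T) c].

(* A spanning tree is identified with its edge set. *)
Definition spanning_trees : {set {set {set V}}} :=
  [set T : {set {set V}} |
    [&& T \subset edges, connected_edges T & acyclic_edges T]].

Definition tree_deg (T : {set {set V}}) (v : V) : nat :=
  #|[set a in T | v \in a]|.

End SpanningTrees.

Section CartesianProduct.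

Variables (r : nat) (n : 'I_r -> nat).

Definition vertex : finType := {dffun forall i : 'I_r, 'I_(n i)}.

Definition prodK_adj : rel vertex :=
  fun u v => #|[set i | u i != v i]| == 1%N.

Definition in_dir (i : 'I_r) (a : {set vertex}) : bool :=
  [exists u in a, exists v in a, u i != v i].

(* inl i indexes q_i, and inr (Tagged _ j) indexes x^(i)_j for j : 'I_(n i);
   the ranges [r] and [n_i] are shifted to start from 0. *)
Definition var : finType := ('I_r + {i : 'I_r & 'I_(n i)})%type.

Definition qvar (i : 'I_r) : {mpoly int[#|var|]} :=
  'X_(enum_rank (inl i : var)).

Definition xvar (i : 'I_r) (j : 'I_(n i)) : {mpoly int[#|var|]} :=
  'X_(enum_rank (inr (Tagged (fun k => 'I_(n k)) j) : var)).

Definition dir_monomial (T : {set {set vertex}}) : {mpoly int[#|var|]} :=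
  \prod_(i < r) qvar i ^+ #|[set a in T | in_dir i a]|.

Definition dd_monomial (T : {set {set vertex}}) : {mpoly int[#|var|]} :=
  \prod_(v : vertex) (\prod_(i < r) xvar (v i)) ^+ tree_deg T v.

Definition tree_enumerator : {mpoly int[#|var|]} :=
  \sum_(T in spanning_trees prodK_adj) dir_monomial T * dd_monomial T.

End CartesianProduct.

Definition divides (R : comNzRingType) (d f : R) : Prop :=
  exists g : R, f = g * d.

(* Main.v *)
Require Import Defs.
From HB Require Import structures.
From mathcomp Require Import all_boot all_order all_fingroup all_algebra.
From mathcomp Require Import mpoly ring.

Set Implicit Arguments.
Unset Strict Implicit.
Unset Printing Implicit Defensive.

Import GRing.Theory.
Local Open Scope ring_scope.

(** Each edge {u, v} in direction k gets the weight q_k X_u X_v, where X_v is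
the product of the x^(k)_(v_k); then the enumerator is the sum over spanning
trees of the products of their edge weights, so by the weighted matrix-tree
theorem ([matrix_tree]) it is a determinant: that of the Laplacian whose row at
a root vertex rho is replaced by a unit vector.

Fix a direction i and write S for the sum of the x^(i)_j.  Adding up the
Laplacian columns of all vertices v with v_i = j gives the vector whose entry
at u is
   q_i x_j y_u ([u_i = j] S - x_(u_i)),   y_u := \prod_(k != i) (x^(k)_(u_k))^2
([prodK_weight_block_sum]): edges in the other directions cancel, and u has at
most one neighbour in direction i with i-th coordinate j.  The block of the
root meets the modified row, so j ranges over the n_i - 1 other values; placing
each of these sums in one column of its block is a unimodular column operation,
and produces n_i - 1 columns divisible by q_i.  Divide them by q_i x_j and
subtract one of the resulting columns from the n_i - 2 others: the terms
x_(u_i) cancel and what is left is divisible by S.  This gives the powers of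
q_i and S ([divides_det_rooted_laplacian]).

The power of x^(i)_j is visible in every single tree: each of the
\prod_(k != i) n_k vertices with i-th coordinate j has positive degree
([divides_dd_monomial]).

The matrix-tree theorem is proved by expanding the determinant along its rows,
each of which is a sum over the possible neighbours of a vertex.  This yields a
sum over all maps phi from vertices to vertices fixing the root, and the
determinant attached to phi is 1 if all iterations of phi end at the root and 0
otherwise ([det_parent_rows_all], [det_parent_rows_lost]).  The surviving phi
are the parent maps of the spanning trees rooted at rho
([sum_spanning_trees]). *)

(** * Spanning trees and parent maps *)

Section ParentMaps.

Variables (V : finType) (rho : V).

Definition parent_map (e : rel V) (phi : {ffun V -> V}) : bool :=
  [&& phi rho == rho, [forall v, (v != rho) ==> e v (phi v)]
    & [forall v, fconnect phi v rho]].

Definition parent_edges (phi : {ffun V -> V}) : {set {set V}} :=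
  [set [set v; phi v] | v in [set~ rho]].

Lemma parent_mapP (e : rel V) (phi : {ffun V -> V}) :
  reflect [/\ phi rho = rho, forall v, v != rho -> e v (phi v)
            & forall v, fconnect phi v rho]
          (parent_map e phi).
Proof.
apply: (iffP and3P) => [[/eqP p1 /forallP p2 /forallP p3]|[p1 p2 p3]]; split=> //.
- by move=> v; apply/implyP.
- by apply/eqP.
- by apply/forallP => v; apply/implyP/p2.
- exact/forallP.
Qed.

Definition depth (phi : {ffun V -> V}) (v : V) : nat := findex phi v rho.

Lemma depth_parent (phi : {ffun V -> V}) v :
  fconnect phi v rho -> v != rho -> depth phi v = (depth phi (phi v)).+1.
Proof. by move=> vr nvr; apply: fconnect_findex => //; rewrite eq_sym. Qed.

Lemma set2_eq (a b c d : V) : [set a; b] = [set c; d] ->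
  (a = c /\ b = d) \/ (a = d /\ b = c).
Proof.
move=> E; have : a \in [set c; d] by rewrite -E set21.
have : b \in [set c; d] by rewrite -E set22.
have : c \in [set a; b] by rewrite E set21.
have : d \in [set a; b] by rewrite E set22.
by case/set2P=> ? /set2P[]? /set2P[]? /set2P[]?; subst; do ?[by left | by right].
Qed.

Lemma parent_neq (e : rel V) (phi : {ffun V -> V}) v :
  parent_map e phi -> v != rho -> phi v != v.
Proof.
move=> /parent_mapP[_ _ p3] nvr; apply/eqP => pv.
by have := depth_parent (p3 v) nvr; rewrite pv => /n_Sn.
Qed.

(** Each application of phi away from the root lowers the depth by one, so phi
has no 2-cycle. *)
Lemma parent_nswap (e : rel V) (phi : {ffun V -> V}) u v :
  parent_map e phi -> u != rho -> v != rho -> phi u = v -> phi v <> u.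
Proof.
move=> /parent_mapP[_ _ p3] nur nvr puv pvu.
have := depth_parent (p3 u) nur; rewrite puv (depth_parent (p3 v) nvr) pvu.
by move/eqP; rewrite -addn2 -[X in X == _]addn0 eqn_add2l.
Qed.

Lemma parent_edge_inj (e : rel V) (phi : {ffun V -> V}) : parent_map e phi ->
  {in [set~ rho] &, injective (fun v => [set v; phi v])}.
Proof.
move=> pp u v; rewrite !inE => nur nvr /set2_eq[[]//|[uv vu]].
by case: (parent_nswap pp nur nvr vu).
Qed.

Lemma parent_edges_rel (phi : {ffun V -> V}) u v :
  edge_rel (parent_edges phi) u v ->
  (u != rho /\ v = phi u) \/ (v != rho /\ u = phi v).
Proof.
move=> /andP[_ /imsetP[t]]; rewrite !inE => ntr /set2_eq[[-> ->]|[-> ->]];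
by [left|right].
Qed.

Lemma edge_rel_sym (T : {set {set V}}) : ssrbool.symmetric (edge_rel T).
Proof. by move=> u v; rewrite /edge_rel eq_sym setUC. Qed.

Lemma parent_edges_connected (e : rel V) (phi : {ffun V -> V}) :
  parent_map e phi -> connected_edges (parent_edges phi).
Proof.
move=> pp; have [p1 p2 p3] := parent_mapP _ _ pp.
have to_root v : connect (edge_rel (parent_edges phi)) v rho.
  move: (p3 v); apply: connect_sub => x _ /= /eqP <-.
  have [->|nxr] := eqVneq x rho; first by rewrite p1 connect0.
  apply: connect1; rewrite /edge_rel eq_sym (parent_neq pp nxr) /=.
  by apply/imsetP; exists x; rewrite ?inE.
apply/forallP => u; apply/forallP => v; apply: connect_trans (to_root u) _.
by rewrite (sym_connect_sym (@edge_rel_sym _)).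
Qed.

(** If they coincided, two steps along the cycle would lead from v back to v. *)
Lemma next_neq_prev (c : seq V) v : uniq c -> (2 < size c)%N -> v \in c ->
  next c v != prev c v.
Proof.
move=> Uc sz vc; apply/eqP => E.
have : next c (next c v) = v by rewrite E next_prev.
case/rot_to: (vc) => i s Es; rewrite -!(next_rot i Uc) Es.
have : uniq (v :: s) by rewrite -Es rot_uniq.
have : (2 < size (v :: s))%N by rewrite -Es size_rot.
case: s {Es} => [|a [|b s]] //= _; rewrite !inE !negb_or eqxx.
move=> /and3P[/and3P[nva nvb _] _ _]; rewrite eq_sym (negPf nva) eqxx.
by move=> Ebv; rewrite Ebv eqxx in nvb.
Qed.

(** On a cycle, both neighbours of a vertex of maximal depth would have to be
its parent. *)
Lemma parent_edges_acyclic (e : rel V) (phi : {ffun V -> V}) :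
  parent_map e phi -> acyclic_edges (parent_edges phi).
Proof.
move=> pp; have [p1 p2 p3] := parent_mapP _ _ pp.
apply/forallP => k; apply/forallP => c; apply/implyP => k2.
apply/negP => /andP[cyc Uc].
have szc : (2 < size c)%N by rewrite size_tuple.
have [v0 v0c] : exists v0, v0 \in tval c.
  by case: (tval c) szc => // a l _; exists a; rewrite inE eqxx.
have [v vc vmax] := arg_maxnP (depth phi) v0c.
have up u : u \in tval c -> edge_rel (parent_edges phi) v u -> u = phi v.
  move=> uc /parent_edges_rel[[]//|[nur vu]].
  by have := vmax u uc; rewrite (depth_parent (p3 u) nur) vu /= ltnn.
have n1 : next c v = phi v.
  by apply: up; rewrite ?mem_next // (next_cycle cyc).
have n2 : prev c v = phi v.
  by apply: up; rewrite ?mem_prev // edge_rel_sym (prev_cycle cyc).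
by have := next_neq_prev Uc szc vc; rewrite n1 n2 eqxx.
Qed.

Lemma parent_edges_spanning (e : rel V) (phi : {ffun V -> V}) :
  parent_map e phi -> parent_edges phi \in spanning_trees e.
Proof.
move=> pp; have [p1 p2 p3] := parent_mapP _ _ pp.
rewrite inE (parent_edges_connected pp) (parent_edges_acyclic pp) !andbT.
apply/subsetP => a /imsetP[v]; rewrite !inE => nvr ->{a}.
by apply/imsetP; exists (v, phi v); rewrite // inE; apply: p2.
Qed.

(** By induction on the depth of v for phi: the edge from v to its parent
phi v is also an edge of psi, and if psi directed it from phi v to v, then, as
the two maps agree at phi v, phi would swap v and phi v. *)
Lemma parent_edges_inj (e : rel V) :
  {in [pred phi | parent_map e phi] &, injective parent_edges}.
Proof.
move=> phi psi; rewrite !inE => pphi ppsi Epp; apply/ffunP => v.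
have [p1 _ p3] := parent_mapP _ _ pphi; have [q1 _ _] := parent_mapP _ _ ppsi.
have [m] := ubnP (depth phi v); elim: m v => // m IHm v.
have [->|nvr] := eqVneq v rho; first by rewrite p1 q1.
rewrite (depth_parent (p3 v) nvr) ltnS => dm.
have : [set v; phi v] \in parent_edges psi.
  by rewrite -Epp; apply/imsetP; exists v; rewrite ?inE.
case/imsetP => t; rewrite !inE => ntr /set2_eq[[-> ->]//|[vt tv]].
have := IHm _ dm; rewrite tv -vt => ptv.
by case: (parent_nswap pphi nvr ntr tv).
Qed.

(** Send each vertex to the next one on a shortest path to the root. *)
Lemma connected_parent_map (e : rel V) :
  (forall v, connect e v rho) -> exists phi, parent_map e phi.
Proof.
move=> conn.
pose P v k := [exists t : k.-tuple V, path e v t && (last v t == rho)].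
have exP v : exists k, P v k.
  have /connectP[p ep Ep] := conn v.
  by exists (size p); apply/existsP; exists (in_tuple p); rewrite /= ep -Ep eqxx.
pose d v := ex_minn (exP v).
have closer v : v != rho -> exists u, e v u && (d u < d v)%N.
  rewrite {2}/d => nvr; case: ex_minnP => k /existsP[t /andP[et lt]] _.
  case: t et lt => -[|u t] /= szt; first by rewrite (negPf nvr).
  move=> /andP[evu et] lt; exists u; rewrite evu -(eqP szt) ltnS /d.
  case: ex_minnP => k' _; apply; apply/existsP; exists (in_tuple t).
  by rewrite /= et.
pose phi := [ffun v => if v == rho then rho
                       else odflt v [pick u | e v u && (d u < d v)%N]].
have phiP v : v != rho -> e v (phi v) && (d (phi v) < d v)%N.
  move=> nvr; rewrite ffunE (negPf nvr); case: pickP => //= no.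
  by have [u] := closer v nvr; rewrite no.
exists phi; apply/parent_mapP; split; first by rewrite ffunE eqxx.
- by move=> v /phiP/andP[].
move=> v; have [m] := ubnP (d v); elim: m v => // m IHm v dm.
have [->|nvr] := eqVneq v rho; first exact: connect0.
have /andP[_ dlt] := phiP v nvr.
by rewrite fconnect_eqVf IHm ?orbT // (leq_trans dlt).
Qed.

(** A connected T contains the edges of some parent map.  These already connect
all vertices, so any further edge of T would close a cycle. *)
Lemma spanning_parent_edges (e : rel V) (T : {set {set V}}) :
  ssrbool.symmetric e -> irreflexive e -> T \in spanning_trees e ->
  exists2 phi, parent_map e phi & T = parent_edges phi.
Proof.
move=> sym_e irr_e; rewrite inE => /and3P[/subsetP sTe conT acT].
have [phi pp] : exists phi, parent_map (edge_rel T) phi.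
  by apply: connected_parent_map => v; move/forallP/(_ v)/forallP/(_ rho): conT.
have [p1 p2 p3] := parent_mapP _ _ pp.
have sphiT : parent_edges phi \subset T.
  apply/subsetP => a /imsetP[v]; rewrite !inE => nvr ->{a}.
  by have /andP[] := p2 v nvr.
have edgeT u v : [set u; v] \in T -> e u v.
  move/sTe/imsetP => [[a b]]; rewrite inE /= => eab.
  by move/set2_eq => [[-> ->]|[-> ->]] //; rewrite sym_e.
exists phi.
  apply/parent_mapP; split=> // v nvr; apply: edgeT.
  by have /andP[] := p2 v nvr.
apply/eqP; rewrite eqEsubset sphiT andbT; apply/subsetP => a aT.
have /imsetP[[u v]] := sTe a aT; rewrite inE /= => euv Ea.
have nuv : u != v by apply: contraTneq euv => ->; rewrite irr_e.
apply: contraT => naphi.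
have := parent_edges_connected pp => /forallP/(_ u)/forallP/(_ v)/connectP[p0].
move=> /shortenP[p ep Up _ {p0}] Ev.
have sub : subrel (edge_rel (parent_edges phi)) (edge_rel T).
  by move=> x y /andP[nxy xy]; rewrite /edge_rel nxy (subsetP sphiT).
have szp : (1 < size p)%N.
  case: p ep Up Ev => [|b [|b' p]] //=.
    by move=> _ _ /eqP; rewrite eq_sym (negPf nuv).
  by move=> /andP[/andP[_ ub] _] _ Ev; move: naphi; rewrite Ea Ev ub.
have szc : (size (u :: p) < #|V|.+1)%N by rewrite ltnS -(card_uniqP Up) max_card.
have /forallP/(_ (Ordinal szc))/forallP/(_ (in_tuple (u :: p)))/implyP := acT.
case/(_ szp)/negP; rewrite /ucycleb Up andbT /= rcons_path (sub_path sub ep) /=.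
by rewrite -Ev /edge_rel eq_sym nuv setUC -Ea.
Qed.

Lemma sum_spanning_trees (R : nzSemiRingType) (e : rel V)
    (F : {set {set V}} -> R) :
  ssrbool.symmetric e -> irreflexive e ->
  \sum_(T in spanning_trees e) F T =
  \sum_(phi | parent_map e phi) F (parent_edges phi).
Proof.
move=> sym_e irr_e.
have -> : spanning_trees e =
    [set parent_edges phi | phi in [pred phi | parent_map e phi]].
  apply/setP => T; apply/idP/imsetP => [/spanning_parent_edges[]//|].
    by move=> phi pp ET; exists phi.
  by case=> phi; rewrite inE => pp ->; apply: parent_edges_spanning.
rewrite big_imset //; exact: parent_edges_inj.
Qed.

End ParentMaps.

Lemma connected_deg_gt0 (V : finType) (e : rel V) (T : {set {set V}}) (v : V) :
  T \in spanning_trees e -> (1 < #|V|)%N -> (0 < tree_deg T v)%N.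
Proof.
rewrite inE => /and3P[_ conT _] V1.
have [u nuv] : exists u, u != v.
  have : (0 < #|[set~ v]|)%N by rewrite cardsC1 -subn1 subn_gt0.
  by case/card_gt0P => u; rewrite !inE; exists u.
move/forallP/(_ v)/forallP/(_ u)/connectP: conT => [[|t p] /= ].
  by move=> _ Euv; rewrite Euv eqxx in nuv.
move=> /andP[/andP[_ vt] _] _; apply/card_gt0P; exists [set v; t].
by rewrite inE vt set21.
Qed.

(** * Determinants of matrices indexed by a finite type *)

Lemma big_fin (A : Type) (idx : A) (op : Monoid.com_law idx) (V : finType)
    (F : V -> A) :
  \big[op/idx]_v F v = \big[op/idx]_(i < #|V|) F (enum_val i).
Proof. by rewrite (reindex _ (onW_bij _ (@enum_val_bij V))). Qed.

Section FiniteTypeMatrices.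

Variables (R : comNzRingType) (V : finType).

Definition fin_mx (F : V -> V -> R) : 'M[R]_#|V| :=
  \matrix_(i, j) F (enum_val i) (enum_val j).

Lemma det_fin_mx (F : V -> V -> R) :
  \det (fin_mx F) =
  \sum_(s : 'S_#|V|) (-1) ^+ s * \prod_v F v (enum_val (s (enum_rank v))).
Proof.
apply: eq_bigr => s _; congr (_ * _); rewrite [RHS]big_fin.
by apply: eq_bigr => i _; rewrite mxE enum_valK.
Qed.

Lemma fin_mxD1M (F N B : V -> V -> R) (s : V -> R) :
  (forall u v, F u v + \sum_t F u t * N t v = B u v * s v) ->
  fin_mx F *m (1%:M + fin_mx N) =
  fin_mx B *m diag_mx (\row_j s (enum_val j)).
Proof.
move=> FN; rewrite mulmxDr mulmx1; apply/matrixP => i j.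
rewrite mul_mx_diag !mxE -FN; congr (_ + _).
by rewrite [RHS]big_fin; apply: eq_bigr => k _; rewrite !mxE.
Qed.

(** Column operations: N records the multiples of columns to be added to other
columns.  As N * N = 0, the matrix 1 + N has inverse 1 - N, so this changes the
determinant by a unit only, and the factors s v can then be taken out of the
columns of the result. *)
Lemma det_column_factor (F N B : V -> V -> R) (s : V -> R) :
  (forall u t v, N u t * N t v = 0) ->
  (forall u v, F u v + \sum_t F u t * N t v = B u v * s v) ->
  exists c, \det (fin_mx F) = c * \det (fin_mx B) * \prod_v s v.
Proof.
move=> NN FN; have NN0 : fin_mx N *m fin_mx N = 0.
  by apply/matrixP => i j; rewrite !mxE big1 // => k _; rewrite !mxE NN.
have inv : (1%:M + fin_mx N) *m (1%:M - fin_mx N) = 1%:M.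
  rewrite mulmxDl mul1mx mulmxBr mulmx1 NN0 subr0.
  by rewrite subrK.
exists (\det (1%:M - fin_mx N)).
have detinv := congr1 determinant inv; rewrite det_mulmx det1 in detinv.
have := congr1 (fun A => \det A * \det (1%:M - fin_mx N)) (fin_mxD1M FN).
rewrite /= !det_mulmx det_diag -[LHS]mulrA detinv mulr1 => ->.
rewrite mulrC mulrA; congr (_ * _).
by rewrite [RHS]big_fin; apply: eq_bigr => k _; rewrite !mxE.
Qed.

(** Multilinearity in the rows, applied to all rows at once. *)
Lemma det_sum_rows (U : finType) (F : V -> U -> V -> R) :
  \det (fin_mx (fun v x => \sum_u F v u x)) =
  \sum_(phi : {ffun V -> U}) \det (fin_mx (fun v x => F v (phi v) x)).
Proof.
under [RHS]eq_bigr do rewrite det_fin_mx.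
rewrite exchange_big det_fin_mx; apply: eq_bigr => s _ /=.
by rewrite -mulr_sumr bigA_distr_bigA.
Qed.

Lemma det_scale_rows (w : V -> R) (F : V -> V -> R) :
  \det (fin_mx (fun v x => w v * F v x)) = (\prod_v w v) * \det (fin_mx F).
Proof.
rewrite !det_fin_mx mulr_sumr; apply: eq_bigr => s _.
by rewrite big_split mulrCA.
Qed.

(** Multiplying by the adjugate shows that \det F annihilates the vector c. *)
Lemma det_kernel (F : V -> V -> R) (c : V -> R) (v0 : V) :
  (forall v, \sum_x F v x * c x = 0) -> c v0 = 1 -> \det (fin_mx F) = 0.
Proof.
move=> Fc0 cv0; pose C : 'cV[R]_#|V| := \col_i c (enum_val i).
have FC : fin_mx F *m C = 0.
  apply/matrixP => i j; rewrite !mxE -[RHS](Fc0 (enum_val i)).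
  by rewrite [RHS]big_fin; apply: eq_bigr => k _; rewrite !mxE.
have /matrixP/(_ (enum_rank v0) 0) : (\det (fin_mx F))%:M *m C = 0.
  by rewrite -mul_adj_mx -mulmxA FC mulmx0.
by rewrite mul_scalar_mx !mxE enum_rankK cv0 mulr1.
Qed.

End FiniteTypeMatrices.

(** * The matrix-tree theorem *)

Section MatrixTree.

Variables (R : comNzRingType) (V : finType) (rho : V).

(** Instead of deleting the row and column of the root, its row is made a unit
vector: the determinant is the same, and the index type stays V. *)
Definition rooted_laplacian (w : V -> V -> R) (v x : V) : R :=
  if v == rho then (x == rho)%:R else (x == v)%:R * \sum_u w v u - w v x.

Definition parent_row (phi : {ffun V -> V}) (v x : V) : R :=
  (x == v)%:R - ((v != rho) && (x == phi v))%:R.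

(** A permutation tau contributing to the Leibniz formula sends each vertex to
itself or to its parent; by induction on the depth, injectivity forces tau to
be the identity. *)
Lemma det_parent_rows_all (phi : {ffun V -> V}) :
  (forall v, fconnect phi v rho) -> \det (fin_mx (parent_row phi)) = 1.
Proof.
move=> reach; rewrite det_fin_mx (bigD1 1%g) //= [X in _ + X]big1 ?addr0.
  rewrite odd_perm1 mul1r big1 // => v _.
  rewrite perm1 enum_rankK /parent_row eqxx.
  have [//|nvr] := eqVneq v rho; rewrite ?subr0 //=.
  have := depth_parent (reach v) nvr.
  by case: eqP => [<- /n_Sn//|]; rewrite subr0.
move=> s ns1; pose tau v := enum_val (s (enum_rank v)).
have tau_inj : injective tau by move=> u v /enum_val_inj/perm_inj/enum_rank_inj.
have [/forallP all_tau|/forallPn[v]] :=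
    boolP [forall v, (tau v == v) || (v != rho) && (tau v == phi v)]; last first.
  rewrite negb_or => /andP[t1 t2].
  rewrite (bigD1 v) //= /parent_row -/(tau v) (negPf t1) (negPf t2).
  by rewrite subr0 mul0r mulr0.
case/eqP: ns1; apply/permP => i; rewrite perm1; apply: enum_val_inj.
suff tau_id v : tau v = v by rewrite -[in LHS](enum_valK i); apply: tau_id.
have [m] := ubnP (depth rho phi v); elim: m v => // m IHm v dm.
have /orP[/eqP//|/andP[nvr /eqP tphi]] := all_tau v.
rewrite (depth_parent (reach v) nvr) ltnS in dm.
by apply: tau_inj; rewrite tphi IHm.
Qed.

(** The indicator of the vertices that never reach the root is in the kernel:
v reaches the root if and only if phi v does. *)
Lemma det_parent_rows_lost (phi : {ffun V -> V}) (v0 : V) :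
  ~~ fconnect phi v0 rho -> \det (fin_mx (parent_row phi)) = 0.
Proof.
move=> lost; apply: (@det_kernel _ _ _ (fun v => (~~ fconnect phi v rho)%:R) v0);
  last by rewrite lost.
move=> v; rewrite /parent_row.
under eq_bigr do rewrite mulrBl; rewrite sumrB (bigD1 v) //= eqxx mul1r.
rewrite big1 ?addr0; last by move=> x /negPf ->; rewrite mul0r.
rewrite (bigD1 (phi v)) //= eqxx andbT [X in _ - (_ + X)]big1; last first.
  by move=> x /negPf ->; rewrite andbF mul0r.
have [->|nvr] := eqVneq v rho; first by rewrite connect0 mul0r addr0 subr0.
by rewrite (fconnect_eqVf phi v) (negPf nvr) mul1r addr0 subrr.
Qed.

(** Away from the root, row v is the sum over u of w v u * (e_v - e_u). *)
Lemma det_rooted_laplacian (w : V -> V -> R) :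
  \det (fin_mx (rooted_laplacian w)) =
  \sum_(phi : {ffun V -> V} | (phi rho == rho) && [forall v, fconnect phi v rho])
     \prod_(v | v != rho) w v (phi v).
Proof.
(* The root row, a unit vector, is put in the same form with all its weight on
     u = rho. *)
pose w' v u := if v == rho then (u == rho)%:R else w v u.
have -> : fin_mx (rooted_laplacian w) =
    fin_mx (fun v x => \sum_u w' v u * ((x == v)%:R - ((v != rho) && (x == u))%:R)).
  apply/matrixP => i j; rewrite !mxE /rooted_laplacian /w'.
  move: (enum_val i) (enum_val j) => v x; case: eqP => [->|nvr] /=.
    rewrite (bigD1 rho) //= eqxx mul1r subr0 big1 ?addr0 //.
    by move=> u /negPf ->; rewrite mul0r.
  under [RHS]eq_bigr do rewrite mulrBr; rewrite sumrB -mulr_suml mulrC; congr (_ - _).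
  rewrite (bigD1 x) //= eqxx mulr1 big1 ?addr0 // => u /negPf nux.
  by rewrite eq_sym nux mulr0.
rewrite det_sum_rows [RHS]big_mkcond; apply: eq_bigr => phi _.
rewrite det_scale_rows -/(parent_row phi) (bigD1 rho) //= {1}/w' eqxx.
have [pr|] := eqVneq (phi rho) rho; last by rewrite !mul0r.
have [/forallP reach|/forallPn[v0 lost]] /= :=
  boolP [forall v, fconnect phi v rho].
  rewrite det_parent_rows_all // mul1r mulr1.
  by apply: eq_bigr => v nvr; rewrite /w' (negPf nvr).
by rewrite (det_parent_rows_lost lost) mulr0.
Qed.

Theorem matrix_tree (e : rel V) (W : {set V} -> R) :
  ssrbool.symmetric e -> irreflexive e ->
  \sum_(T in spanning_trees e) \prod_(a in T) W a =
  \det (fin_mx (rooted_laplacian (fun u v => (e u v)%:R * W [set u; v]))).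
Proof.
move=> sym_e irr_e; rewrite (@sum_spanning_trees _ rho) // det_rooted_laplacian.
rewrite [LHS]big_mkcond [RHS]big_mkcond; apply: eq_bigr => phi _.
have [pp|] := boolP (parent_map rho e phi).
  have [-> p2 p3] := parent_mapP _ _ _ pp; rewrite eqxx (introT forallP p3) /=.
  rewrite big_imset /=; last exact: parent_edge_inj pp.
  apply: eq_big => [v|v]; rewrite !inE // => nvr.
  by rewrite p2 // mul1r.
rewrite /parent_map; case: eqP => //= _; case: [forall v, fconnect _ _ _] => //.
rewrite andbT => /forallPn[v]; rewrite negb_imply => /andP[nvr /negPf evn].
by rewrite (bigD1 v) //= evn !mul0r.
Qed.

End MatrixTree.

(** * Column operations on a Laplacian with a block structure *)

Section ColumnOperations.

Variables (R : comNzRingType) (V : finType) (m : nat) (rho : V).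
Variables (col : V -> 'I_m) (g : 'I_m -> V).
(** The vertices are grouped in blocks by col, and g j is a chosen member of
block j. *)
Hypothesis gK : cancel g col.
Variables (w : V -> V -> R) (q : R) (x : 'I_m -> R) (y : V -> R).

Let S : R := \sum_j x j.

Hypothesis block_sum : forall u j,
  (col u == j)%:R * \sum_v w u v - \sum_(v | col v == j) w u v =
  q * x j * (y u * ((col u == j)%:R * S - x (col u))).

(** The columns that receive the sum of their block.  The block of the root is
left out, because its sum is not zero in the row of the root. *)
Let pivot (v : V) : bool := (v == g (col v)) && (col v != col rho).

(** The matrix after summing blocks and dividing the pivot columns by
q * x (col v). *)
Let block_col (u v : V) : R :=
  if pivot v then (u != rho)%:R * (y u * ((col u == col v)%:R * S - x (col u)))
  else rooted_laplacian rho w u v.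

Lemma rooted_laplacian_block_sum u j : j != col rho ->
  \sum_(v | col v == j) rooted_laplacian rho w u v =
  (u != rho)%:R * (q * x j * (y u * ((col u == j)%:R * S - x (col u)))).
Proof.
move=> nj; rewrite /rooted_laplacian; case: eqP => [_|nur] /=.
  rewrite mul0r big1 // => v /eqP cv.
  by case: eqP => // vr; rewrite -cv vr eqxx in nj.
rewrite mul1r -block_sum sumrB; congr (_ - _).
rewrite -mulr_suml; congr (_ * _); rewrite big_mkcond (bigD1 u) //= eqxx.
rewrite big1 ?addr0; last by move=> v /negPf ->; rewrite if_same.
by case: eqP.
Qed.

Lemma det_pivot_columns : exists c,
  \det (fin_mx (rooted_laplacian rho w)) =
  c * \det (fin_mx block_col) * \prod_(v | pivot v) (q * x (col v)).
Proof.
pose N (t v : V) : R := [&& pivot v, col t == col v & t != v]%:R.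
have NN u t v : N u t * N t v = 0.
  rewrite /N -natrM mulnb; case: andP => // -[/and3P[/andP[/eqP Et _] _ _]].
  by case/and3P=> /andP[/eqP Ev _] /eqP ctv /eqP[]; rewrite Et ctv -Ev.
have FN u v : rooted_laplacian rho w u v
      + \sum_t rooted_laplacian rho w u t * N t v =
    block_col u v * (if pivot v then q * x (col v) else 1).
  rewrite /block_col /N; case: ifP => [pv|npv]; last first.
    by rewrite big1 ?addr0 ?mulr1 // => t _; rewrite mulr0.
  have /andP[_ ncv] := pv.
  have -> : (u != rho)%:R * (y u * ((col u == col v)%:R * S - x (col u)))
       * (q * x (col v)) =
     \sum_(t | col t == col v) rooted_laplacian rho w u t.
    rewrite rooted_laplacian_block_sum // -mulrA; congr (_ * _).
    by rewrite mulrC.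
  rewrite [RHS](bigD1 v) //=; congr (_ + _).
  rewrite [RHS]big_mkcond; apply: eq_bigr => t _ /=.
  by case: ifP => _; rewrite ?mulr1 ?mulr0.
have [c ->] := det_column_factor NN FN; exists c.
by rewrite -big_mkcond.
Qed.

(** Subtracting the pivot column of block j1 from the other pivot columns
cancels x (col u), the only part of these columns that S need not divide. *)
Lemma det_pivot_differences (j1 : 'I_m) : j1 != col rho -> exists c,
  \det (fin_mx block_col) = c * \prod_(v | pivot v && (col v != j1)) S.
Proof.
move=> nj1; pose P v := pivot v && (col v != j1).
pose N (t v : V) : R := - (P v && (t == g j1))%:R.
pose B u v := if P v then (u != rho)%:R * (y u * ((col u == col v)%:R - (col u == j1)%:R))
              else block_col u v.
have NN u t v : N u t * N t v = 0.
  rewrite /N mulrNN -natrM mulnb.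
  case: (altP (t =P g j1)) => [->|]; last by rewrite !andbF.
  by rewrite /P gK eqxx andbF.
have pg : pivot (g j1) by rewrite /pivot gK eqxx.
have FN u v : block_col u v + \sum_t block_col u t * N t v =
    B u v * (if P v then S else 1).
  rewrite /B /N; case: ifP => [Pv|nPv]; last first.
    by rewrite big1 ?addr0 ?mulr1 // => t _; rewrite oppr0 mulr0.
  rewrite (bigD1 (g j1)) //= eqxx big1 ?addr0; last first.
    by move=> t /negPf ->; rewrite oppr0 mulr0.
  have /andP[pv _] := Pv.
  rewrite mulrN1 /block_col pv pg gK -mulrBr -mulrA -mulrBr -mulrA.
  by rewrite mulrBl opprB addrA subrK.
have [c ->] := det_column_factor NN FN.
by exists (c * \det (fin_mx B)); rewrite -big_mkcond.
Qed.

Lemma card_pivot : #|[pred v | pivot v]| = m.-1.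
Proof.
have -> : #|[pred v | pivot v]| = #|[set g j | j in [set~ col rho]]|.
  apply: eq_card => v; rewrite !inE; apply/andP/imsetP => [[/eqP Ev ncv]|[j]].
    by exists (col v); rewrite // !inE.
  by rewrite !inE => nj ->; rewrite gK.
by rewrite card_imset ?cardsC1 ?card_ord //; apply: can_inj gK.
Qed.

Lemma card_pivot_but (j1 : 'I_m) : j1 != col rho ->
  #|[pred v | pivot v && (col v != j1)]| = (m - 2)%N.
Proof.
move=> nj1; have := card_pivot; rewrite (cardD1 (g j1)) !inE /pivot gK eqxx nj1.
rewrite add1n subn2 => <-; apply: eq_card => v.
rewrite !inE /= [RHS]andbC; case pv : (v == g (col v)); rewrite //= ?andbF //.
by congr (_ && _); rewrite -(can_eq gK) -(eqP pv).
Qed.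

Lemma divides_det_rooted_laplacian :
  divides (q ^+ (m - 1)) (\det (fin_mx (rooted_laplacian rho w))) /\
  divides (S ^+ (m - 2)) (\det (fin_mx (rooted_laplacian rho w))).
Proof.
have [c Ec] := det_pivot_columns; split.
  exists (c * \det (fin_mx block_col) * \prod_(v | pivot v) x (col v)).
  by rewrite Ec big_split /= prodr_const card_pivot subn1 mulrA mulrAC.
have [m1|m2] := leqP m 1.
  by exists (\det (fin_mx (rooted_laplacian rho w))); 
  by have /eqP -> : (m - 2 == 0)%N; rewrite ?mulr1 // subn_eq0 (leq_trans m1).
have [j1 nj1] : exists j1, j1 != col rho.
  have : (0 < #|[set~ col rho]|)%N by rewrite cardsC1 card_ord -subn1 subn_gt0.
  by case/card_gt0P => j1; rewrite !inE; exists j1.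
have [c' Ec'] := det_pivot_differences nj1.
exists (c * c' * \prod_(v | pivot v) (q * x (col v))).
by rewrite Ec Ec' prodr_const card_pivot_but // mulrA mulrAC.
Qed.

End ColumnOperations.

(** * Products of complete graphs *)

Section CompleteProducts.

Variables (r : nat) (n : 'I_r -> nat).

Local Notation vertex := (vertex n).

Lemma prodK_adj_sym : ssrbool.symmetric (@prodK_adj r n).
Proof.
move=> u v; rewrite /prodK_adj; congr (_ == _).
by apply: eq_card => k; rewrite !inE eq_sym.
Qed.

Lemma prodK_adj_irr : irreflexive (@prodK_adj r n).
Proof.
move=> u; rewrite /prodK_adj eq_card0 // => k; by rewrite !inE eqxx.
Qed.

(** An edge lies in exactly one direction k, so the first product is a single
q_k; written as a product it makes sense for every set of vertices. *)
Definition edge_monomial (a : {set vertex}) : {mpoly int[#|var n|]} :=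
  (\prod_(k < r | in_dir k a) qvar n k) *
  \prod_(v in a) \prod_(k < r) xvar (v k).

Lemma tree_monomialE (T : {set {set vertex}}) :
  dir_monomial T * dd_monomial T = \prod_(a in T) edge_monomial a.
Proof.
rewrite /dir_monomial /dd_monomial big_split /=; congr (_ * _).
  under eq_bigr do rewrite -prodr_const; rewrite (exchange_big_dep (mem T)) /=.
    by apply: eq_bigr => a aT; apply: eq_bigl => k; rewrite inE aT.
  by move=> k a _; rewrite inE => /andP[].
under eq_bigr do rewrite -prodr_const; rewrite (exchange_big_dep (mem T)) /=.
  by apply: eq_bigr => a aT; apply: eq_bigl => k; rewrite inE aT.
by move=> k a _; rewrite inE => /andP[].
Qed.

Definition move_to (i : 'I_r) (u : vertex) (j : 'I_(n i)) : vertex :=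
  finfun (dfwith u j).

Lemma move_to_in i (u : vertex) (j : 'I_(n i)) : move_to u j i = j.
Proof. by rewrite ffunE dfwith_in. Qed.

Lemma move_to_out i (u : vertex) (j : 'I_(n i)) k : k != i -> move_to u j k = u k.
Proof. by rewrite eq_sym => nik; rewrite ffunE dfwith_out. Qed.

Definition prodK_weight (u v : vertex) : {mpoly int[#|var n|]} :=
  (prodK_adj u v)%:R * edge_monomial [set u; v].

Definition rest_monomial (i : 'I_r) (u : vertex) : {mpoly int[#|var n|]} :=
  \prod_(k < r | k != i) xvar (u k) ^+ 2.

Lemma prodK_weight_move i (u : vertex) (j : 'I_(n i)) : u i != j ->
  prodK_weight u (move_to u j) =
  qvar n i * xvar (u i) * xvar j * rest_monomial i u.
Proof.
move=> nuj; have diffE k : (u k != move_to u j k) = (k == i).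
  have [->|nki] := eqVneq k i; first by rewrite move_to_in.
  by rewrite move_to_out ?eqxx.
have nu : u != move_to u j.
  by apply: contraNneq nuj => E; rewrite {1}E move_to_in.
have Ediff : [set k | u k != move_to u j k] = [set i].
  by apply/setP => k; rewrite !inE diffE.
rewrite /prodK_weight /prodK_adj Ediff cards1 eqxx mul1r.
rewrite /edge_monomial big_setU1 ?inE //= big_set1.
rewrite (big_pred1 i); last first.
  move=> k; rewrite -[RHS]/(k == i) -diffE; apply/exists_inP/idP => [[a]|].
    rewrite !inE => /orP[]/eqP-> /exists_inP[b]; rewrite !inE => /orP[]/eqP->;
    by rewrite ?eqxx // eq_sym.
  by exists u; rewrite ?set21 //; apply/exists_inP; exists (move_to u j); rewrite ?set22.
rewrite -!mulrA; congr (_ * _); rewrite (bigD1 i) //= [in X in _ * X](bigD1 i) //=.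
rewrite move_to_in mulrACA -mulrA -big_split; do 2!congr (_ * _).
by apply: eq_bigr => k nki; rewrite move_to_out.
Qed.

(** In the block of vertices with i-th coordinate j != u i, the only neighbour
of u is the one that differs from u in direction i alone. *)
Lemma prodK_weight_block i (u : vertex) (j : 'I_(n i)) : u i != j ->
  \sum_(v : vertex | v i == j) prodK_weight u v =
  qvar n i * xvar (u i) * xvar j * rest_monomial i u.
Proof.
move=> nuj; rewrite (bigD1 (move_to u j)) ?move_to_in //= prodK_weight_move //.
rewrite big1 ?addr0 // => v /andP[/eqP vj]; apply: contraNeq => wn0.
have : prodK_adj u v.
  by apply: contraNT wn0 => /negPf E; rewrite /prodK_weight E mul0r.
move=> /cards1P[k Ek].
have diffE k' : (u k' != v k') = (k' == k) by have := in_set1 k' k; rewrite -Ek inE.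
have Ei : i = k by apply/eqP; rewrite -diffE vj.
apply/eqP/ffunP => k'; have [->|nk] := eqVneq k' i; first by rewrite move_to_in.
by rewrite move_to_out //; apply/eqP; rewrite eq_sym -[_ == _]negbK diffE -Ei.
Qed.

(** For j = u i, the row sum minus the sum over the block of u leaves the edges
to the other blocks, which all lie in direction i. *)
Lemma prodK_weight_block_sum i (u : vertex) (j : 'I_(n i)) :
  (u i == j)%:R * \sum_v prodK_weight u v
    - \sum_(v : vertex | v i == j) prodK_weight u v =
  qvar n i * xvar j *
  (rest_monomial i u * ((u i == j)%:R * (\sum_(j' < n i) xvar j') - xvar (u i))).
Proof.
have [<-|nuj] := eqVneq (u i) j; last first.
  rewrite !mul0r !sub0r prodK_weight_block // !mulrN; congr (- _).
  by rewrite -!mulrA; congr (_ * _); rewrite mulrCA; congr (_ * _); rewrite mulrC.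
rewrite !mul1r (bigID (fun v : vertex => v i == u i)) /= addrC addrK.
rewrite (partition_big (fun v : vertex => v i) (fun j => j != u i)) //=.
rewrite [in RHS](bigD1 (u i)) //= addrAC subrr add0r !mulr_sumr.
apply: eq_bigr => j' nj'.
under eq_bigl => v.
  have -> : (v i != u i) && (v i == j') = (v i == j').
    by rewrite andbC; case: eqP => //= ->.
  over.
by rewrite prodK_weight_block 1?eq_sym //; ring.
Qed.

Lemma tree_enumerator_det (rho : vertex) :
  tree_enumerator n = \det (fin_mx (rooted_laplacian rho prodK_weight)).
Proof.
rewrite -(matrix_tree rho (@edge_monomial) prodK_adj_sym prodK_adj_irr).
by apply: eq_bigr => T _; apply: tree_monomialE.
Qed.

(** The layer is a product of finite sets, with a singleton in coordinate i. *)
Lemma card_layer (i : 'I_r) (j : 'I_(n i)) :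
  #|[pred v : vertex | v i == j]| = (\prod_(k < r | k != i) n k)%N.
Proof.
pose F (k : 'I_r) : pred 'I_(n k) := fun a => (k != i) || (val a == val j).
have -> : #|[pred v : vertex | v i == j]| = #|(family F : simpl_pred vertex)|.
  apply: eq_card => v; rewrite !inE; apply/idP/familyP => [/eqP vj k|/(_ i)].
    by rewrite unfold_in /F; have [->|] := eqVneq k i; rewrite ?vj ?eqxx ?orbT.
  by rewrite unfold_in /F eqxx.
rewrite card_family foldrE big_map [LHS]big_enum /= big_mkcond [RHS]big_mkcond /=.
apply: eq_bigr => k _; have [->|nki] := eqVneq k i.
  by rewrite -(card1 j); apply: eq_card => a; rewrite !unfold_in /F eqxx.
by rewrite -[RHS]card_ord; apply: eq_card => a; rewrite !unfold_in /F nki.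
Qed.

End CompleteProducts.

Lemma divides_sum (R : comNzRingType) (I : finType) (P : pred I) (F : I -> R) d :
  (forall k, P k -> divides d (F k)) -> divides d (\sum_(k | P k) F k).
Proof.
move=> dF; apply: (big_ind (divides d)) => //.
- by exists 0; rewrite mul0r.
- by move=> _ _ [a ->] [b ->]; exists (a + b); rewrite mulrDl.
Qed.

Lemma divides_dd_monomial (r : nat) (n : 'I_r -> nat) (i : 'I_r) (j : 'I_(n i))
    (T : {set {set vertex n}}) :
  (forall v, (0 < tree_deg T v)%N) ->
  divides (xvar j ^+ (\prod_(k < r | k != i) n k)%N) (dd_monomial T).
Proof.
move=> deg_gt0; rewrite -(card_layer j) /dd_monomial.
rewrite (bigID [pred v : vertex n | v i == j]) /= mulrC.
set A := \prod_(v | _) _; set B := \prod_(v : vertex n | v i == j) _.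
pose C := \prod_(v : vertex n | v i == j) (xvar j ^+ (tree_deg T v).-1
   * (\prod_(k < r | k != i) xvar (v k)) ^+ tree_deg T v).
exists (A * C); rewrite -prodr_const -mulrA -big_split /=; congr (_ * _).
apply: eq_bigr => v /eqP vj; rewrite (bigD1 i) //= vj exprMn.
by rewrite -{1}(prednK (deg_gt0 v)) exprSr mulrAC.
Qed.

(* The premise 1 < n_1 ... n_r of the second item only excludes the one-vertex
   graph, whose enumerator is 1. For n_i = 1 the exponent n_i - 2 is truncated
   to 0; the corresponding claim is trivial either way. *)
Theorem theorem2 (r : nat) (n : 'I_r -> nat) (n_gt0 : forall i, (0 < n i)%N) :
  forall i : 'I_r,
    [/\ divides (qvar n i ^+ (n i - 1)) (tree_enumerator n),
        (1 < \prod_(k < r) n k)%N ->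
          forall j : 'I_(n i),
            divides (xvar j ^+ (\prod_(k < r | k != i) n k)%N)
                    (tree_enumerator n)
      & divides ((\sum_(j < n i) xvar j) ^+ (n i - 2)) (tree_enumerator n)].
Proof.
move=> i; pose rho : vertex n := [ffun k => Ordinal (n_gt0 k)].
have gK : cancel (move_to rho) (fun v : vertex n => v i).
  by move=> j; apply: move_to_in.
have [div_q div_S] :=
  divides_det_rooted_laplacian rho gK (@prodK_weight_block_sum r n i).
rewrite (tree_enumerator_det rho); split=> // n_gt1 j.
rewrite -tree_enumerator_det; apply: divides_sum => T spT.
have deg_gt0 v : (0 < tree_deg T v)%N.
  apply: connected_deg_gt0 spT _.
  rewrite (card_dep_ffun (fun k => 'I_(n k))) foldrE big_map big_enum.
  by under eq_bigr do rewrite card_ord.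
have [c ->] := divides_dd_monomial j deg_gt0.
by exists (dir_monomial T * c); rewrite mulrA.
Qed.
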